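(* Let $0<\alpha<1$ and $0\le\rho<1-(1+\alpha)^{-1/2}$ be real numbers. Let $q,n,d,\ell,m$ be positive integers and let $\mathcal{C}\subseteq[q]^n$ be a code of minimum distance at least $n-nq^{-1}-d$. Put $\gamma=(1+\alpha)(1-\rho)^2-1$ and $\sigma=(1-\rho)(2-\rho)^{-1}$. Suppose \[ d\ge nq^{-1},\qquad 4\gamma^{-1}\le\ell\le \tfrac{1}{800}\,\sigma\gamma\, n d^{-1},\qquad \sigma m\ge 1280\sqrt{\ell\gamma^{-1}}\,\log|\mathcal{C}|,\qquad m<n. \] Then for $S$ chosen uniformly at random among the $m$-element subsets of $[n]$, the probability that $\mathcal{C}_S$ is $(\rho,\ell,\ell(1+\alpha))$-list recoverable is at least $1-e^{-\sigma m/64}$.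
   Context: For $c\in[q]^N$ and $\mathcal{L}\subseteq[q]^N$, $\Delta(c,\mathcal{L})$ is the minimum Hamming distance from $c$ to an element of $\mathcal{L}$. A code $\mathcal{C}\subseteq[q]^N$ is $(\rho,\ell,L)$-list recoverable if for all $A_1,\dots,A_N\subseteq[q]$ with each $|A_i|\le\ell$, at most $L$ codewords $c\in\mathcal{C}$ satisfy $\Delta(c,A_1\times\cdots\times A_N)\le\rho N$. For $S\subseteq[n]$, $\mathcal{C}_S\subseteq[q]^S$ is the puncturing of $\mathcal{C}$ to $S$, i.e. the set of restrictions of codewords of $\mathcal{C}$ to the coordinates in $S$ (block length $|S|$). $\log$ denotes the natural logarithm. *)

(* Defs.v *)
From HB Require Import structures.
From mathcomp Require Import all_boot all_order all_algebra.
From mathcomp Require Import all_classical all_reals all_analysis.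
Set Implicit Arguments. Unset Strict Implicit. Unset Printing Implicit Defensive.
Import Order.TTheory GRing.Theory Num.Theory.
Local Open Scope ring_scope.

Definition hamming (I : finType) (q : nat) (c y : {ffun I -> 'I_q}) : nat :=
  #|[set i | c i != y i]|.

Definition min_dist_ge (R : realType) (I : finType) (q : nat)
    (C : {set {ffun I -> 'I_q}}) (D : R) : Prop :=
  forall c c', c \in C -> c' \in C -> c != c' -> D <= (hamming c c')%:R.

(* Delta(c, A_1 x ... x A_N) <= rho * N  iff some word of the product set is
   within Hamming distance rho*N of c (N = #|I| = block length). *)
Definition close_to_prod (R : realType) (I : finType) (q : nat)
    (rho : R) (A : {ffun I -> {set 'I_q}}) (c : {ffun I -> 'I_q}) : bool :=
  [exists y : {ffun I -> 'I_q},
     [forall i, y i \in A i] && ((hamming c y)%:R <= rho * #|I|%:R)].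

Definition list_recoverable (R : realType) (I : finType) (q : nat)
    (C : {set {ffun I -> 'I_q}}) (rho : R) (ell : nat) (L : R) : bool :=
  [forall A : {ffun I -> {set 'I_q}},
     [forall i, #|A i| <= ell]%N ==>
     (#|[set c in C | close_to_prod rho A c]|%:R <= L)].

Definition puncture (n q : nat) (C : {set {ffun 'I_n -> 'I_q}})
    (S : {set 'I_n}) : {set {ffun {i : 'I_n | i \in S} -> 'I_q}} :=
  [set [ffun i : {i : 'I_n | i \in S} => c (val i)] | c : {ffun 'I_n -> 'I_q} in C].

(* Main.v *)
(** If [S] is bad, take [K] codewords of [C], [ell (1 + alpha) < K <= 2 ell],
whose restrictions to [S] are close to [prod_i A_i]. On at least [sigma m]
coordinates [i] of [S], at least [(1 + gamma) ell] of them take their value in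
[A_i], so that pairing each codeword with the next one having the same symbol
gives at least [gamma ell] colliding pairs. By the second moment method, two
random [t]-tuples of these codewords, with [t] about [sqrt (ell / gamma) / 2],
collide at such a coordinate with probability at least [1/90]; hence some two
[t]-tuples of codewords collide on at least [sigma m / 90] coordinates of [S].
The minimum distance bounds the density in ['I_n] of the set of coordinates
where two given [t]-tuples collide by [2 d t^2 / n <= sigma / 1600], so a
Chernoff bound followed by a union bound over the [|C|^(2t)] pairs of tuples
concludes. *)

Require Import Defs.
From HB Require Import structures.
From mathcomp Require Import all_boot all_order all_algebra.
From mathcomp Require Import all_classical all_reals all_analysis.
From mathcomp Require Import ring lra zify.
Import Order.TTheory GRing.Theory Num.Theory.
Local Open Scope ring_scope.

(** * Expectations over finite uniform spaces *)

Definition avg {R : realFieldType} {W : finType} (f : W -> R) : R :=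
  (\sum_w f w) / #|W|%:R.

Section Avg.
Context {R : realFieldType} {W : finType}.
Implicit Types f g : W -> R.

Lemma eq_avg f g : f =1 g -> avg f = avg g.
Proof. by move=> fg; congr (_ / _); apply: eq_bigr => w _. Qed.

Lemma avgD f g : avg (fun w => f w + g w) = avg f + avg g.
Proof. by rewrite /avg big_split /= mulrDl. Qed.

Lemma avgZ a f : avg (fun w => a * f w) = a * avg f.
Proof. by rewrite /avg -mulr_sumr mulrA. Qed.

Lemma le_avg f g : (forall w, f w <= g w) -> avg f <= avg g.
Proof. by move=> fg; rewrite ler_wpM2r ?invr_ge0// ler_sum. Qed.

Lemma avg_sum (T : finType) (P : pred T) (F : T -> W -> R) :
  avg (fun w => \sum_(j | P j) F j w) = \sum_(j | P j) avg (F j).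
Proof. by rewrite /avg exchange_big /= mulr_suml. Qed.

Lemma exchange_avg (T : finType) (F : W -> T -> R) :
  avg (fun w => avg (F w)) = avg (fun j => avg (F^~ j)).
Proof.
by rewrite /avg -!mulr_suml exchange_big /= mulrAC.
Qed.

Lemma avg_witness f c : (0 < #|W|)%N -> c <= avg f -> exists w, c <= f w.
Proof.
move=> W0 cf; case: (pickP (fun w => c <= f w)) => [w cw|no]; first by exists w.
exfalso; move: cf; apply/negP; rewrite -ltNge /avg ltr_pdivrMr ?ltr0n//.
rewrite mulr_natr -sumr_const; apply: ltr_sum => [|w _]; last by rewrite ltNge no.
by case/card_gt0P: W0 => w _; apply/hasP; exists w; rewrite ?mem_index_enum.
Qed.

End Avg.

(** * Moments of sums over the entries of a uniformly random tuple *)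

Section AvgFfun.
Context {R : realFieldType} {T V : finType}.
Context (V0 : (0 < #|V|)%N).
Implicit Types f : V -> R.

(** Independence of the entries of a random tuple. Factors 1 are inserted outside [A] so that
    product and sum can be exchanged; they average to 1 because [V] is nonempty. *)
Lemma avg_ffun_prod (A : {set T}) (f : T -> V -> R) :
  avg (fun x : {ffun T -> V} => \prod_(j in A) f j (x j)) = \prod_(j in A) avg (f j).
Proof.
have K0 : #|V|%:R != 0 :> R by rewrite pnatr_eq0 -lt0n.
rewrite /avg card_ffun natrX.
transitivity ((\prod_j \sum_v (if j \in A then f j v else 1)) / #|V|%:R ^+ #|T|).
  by congr (_ / _); rewrite bigA_distr_bigA; apply: eq_bigr => x _; rewrite big_mkcond.
rewrite -(prodr_const T) -prodf_div [RHS]big_mkcond /=.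
apply: eq_bigr => j _; case: ifP => // _.
by rewrite sumr_const divff.
Qed.

Lemma avg_ffun1 f (a : T) : avg (fun x : {ffun T -> V} => f (x a)) = avg f.
Proof.
have := avg_ffun_prod [set a] (fun _ => f); rewrite big_set1 => <-.
by apply: eq_avg => x; rewrite big_set1.
Qed.

Lemma avg_ffun2 f (a b : T) : a != b ->
  avg (fun x : {ffun T -> V} => f (x a) * f (x b)) = avg f ^+ 2.
Proof.
move=> ab; have := avg_ffun_prod [set a; b] (fun _ => f).
rewrite big_setU1 ?inE//= big_set1 -expr2 => <-.
by apply: eq_avg => x; rewrite big_setU1 ?inE//= big_set1.
Qed.

Lemma avg_ffun_sum f :
  avg (fun x : {ffun T -> V} => \sum_a f (x a)) = #|T|%:R * avg f.
Proof.
by rewrite avg_sum; under eq_bigr do rewrite avg_ffun1; rewrite sumr_const mulr_natl.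
Qed.

(** The diagonal gives the first term. Off-diagonal pairs are independent, and their number is
    rounded up to [#|T| ^ 2]. *)
Lemma avg_ffun_sum_sqr f :
  avg (fun x : {ffun T -> V} => (\sum_a f (x a)) ^+ 2)
    <= #|T|%:R * avg (fun v => f v ^+ 2) + #|T|%:R ^+ 2 * avg f ^+ 2.
Proof.
under eq_avg do rewrite expr2 mulr_suml.
rewrite avg_sum.
have -> : #|T|%:R * avg (fun v => f v ^+ 2) + #|T|%:R ^+ 2 * avg f ^+ 2
  = \sum_(a : T) (avg (fun v => f v ^+ 2) + #|T|%:R * avg f ^+ 2).
  by rewrite sumr_const -mulr_natl; ring.
apply: ler_sum => a _.
under eq_avg do rewrite mulr_sumr (bigD1 a) //= -expr2.
rewrite avgD (avg_ffun1 (fun v => f v ^+ 2)) lerD2l avg_sum.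
rewrite mulr_natl -sumr_const.
apply: (@le_trans _ _ (\sum_(b | b != a) avg f ^+ 2)).
  by apply: ler_sum => b ba; rewrite avg_ffun2// eq_sym.
by rewrite [leLHS]big_mkcond; apply: ler_sum => b _; case: ifP => // _; rewrite sqr_ge0.
Qed.

End AvgFfun.

(** * Collisions at one coordinate: hitting probability and pairing of equal symbols *)

Section Hit.
Context {R : realFieldType} {T V : finType} (U : {set V}) (g : V -> V).
Context (V0 : (0 < #|V|)%N).
Context (g_inj : {in U &, injective g}).
Let t : R := #|T|%:R.
Let K : R := #|V|%:R.
Let mu : R := #|U|%:R.

Let p : R := t ^+ 2 * mu / K ^+ 2.
Let h (v u : V) : R := ((u \in U) && (v == g u))%:R.

Let K0 : 0 < K. Proof. by rewrite ltr0n. Qed.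

Let sum_hl u : \sum_v h v u = (u \in U)%:R.
Proof.
rewrite /h; case: (u \in U) => /=; last by rewrite big1.
by rewrite (bigD1 (g u))//= eqxx big1 ?addr0// => v /negbTE ->.
Qed.

(** Injectivity of [g] enters here: it controls pairs of hits that share the same position of
    [y]. *)
Let sum_hr v : \sum_u h v u <= 1.
Proof.
case: (pickP [pred u | (u \in U) && (v == g u)]) => [u /= uP|no]; last first.
  by rewrite big1 ?ler01// => u _; have /= := no u; rewrite /h => ->.
rewrite (bigD1 u)//= /h uP big1 ?addr0// => w wu.
case: andP => // -[wU /eqP vgw]; case/andP: uP => uU /eqP vgu.
by rewrite (g_inj w u) ?eqxx// -?vgw in wu.
Qed.

Let avg_mem : avg (fun u => (u \in U)%:R : R) = mu / K.
Proof.
congr (_ / _); rewrite /mu -sum1_card natr_sum [RHS]big_mkcond /=.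
by apply: eq_bigr => u _; case: (u \in U).
Qed.

Let avg_h_ge0 v : 0 <= avg (h v).
Proof. by rewrite divr_ge0 ?ler0n// sumr_ge0// => u _; rewrite ler0n. Qed.

Let avg_h_le v : avg (h v) <= K^-1.
Proof. by rewrite -[leRHS]mul1r /avg ler_wpM2r ?sum_hr// invr_ge0 ltW. Qed.

Let avg_avg_h : avg (fun v => avg (h v)) = mu / K / K.
Proof.
rewrite exchange_avg -avg_mem -[RHS]mulrC -avgZ; apply: eq_avg => u.
by rewrite /avg sum_hl mulrC.
Qed.

(* Second moment method, through [1[X > 0] >= 2 X - X ^ 2] for the number [X] of
   pairs of positions [(a, b)] with [x a \in U] and [y b = g (x a)]. *)
Lemma avg_hit_ge :
  p * (1 - 2 * t / K - p) <=
  avg (fun x : {ffun T -> V} => avg (fun y : {ffun T -> V} =>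
    [exists a, exists b, (x a \in U) && (y b == g (x a))]%:R)).
Proof.
pose phi (x : {ffun T -> V}) v := \sum_a h v (x a).
have avg_phi x : avg (phi x) = K^-1 * \sum_a (x a \in U)%:R.
  by rewrite avg_sum mulr_sumr; apply: eq_bigr => a _; rewrite /avg sum_hl mulrC.
pose X (x y : {ffun T -> V}) := \sum_b phi x (y b).
have XE x : avg (X x) = t * avg (phi x) by rewrite avg_ffun_sum.
have EX : avg (fun x => avg (X x)) = p.
  under eq_avg do rewrite XE avg_phi.
  rewrite avgZ avgZ (avg_ffun_sum V0 (fun u => (u \in U)%:R)) avg_mem -/t.
  by rewrite /p; field; rewrite gt_eqF.
(* The second moment bound is applied over [y], then over [x] to each of the two resulting terms.
   Pairs of hits sharing exactly one position cost [t / K * p] for each side, disjoint pairs cost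
   [p ^ 2]. *)
have EX2 : avg (fun x => avg (fun y => X x y ^+ 2)) <= p + 2 * t / K * p + p ^+ 2.
  apply: (@le_trans _ _ (avg (fun x : {ffun T -> V} => t * avg (fun v => phi x v ^+ 2) +
     t ^+ 2 * K^-1 ^+ 2 * (\sum_a (x a \in U)%:R) ^+ 2))).
    apply: le_avg => x; apply: (le_trans (avg_ffun_sum_sqr V0 (phi x))).
    by rewrite lerD2l avg_phi exprMn mulrA.
  rewrite avgD !avgZ exchange_avg.
  have H1 : avg (fun v => avg (fun x : {ffun T -> V} => phi x v ^+ 2)) <=
      avg (fun v => (t + t ^+ 2 / K) * avg (h v)).
    apply: le_avg => v; apply: (le_trans (avg_ffun_sum_sqr V0 (h v))).
    rewrite mulrDl lerD//; last first.
      by rewrite -/t -mulrA ler_wpM2l ?sqr_ge0// expr2 ler_wpM2r.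
    rewrite ler_wpM2l// le_avg// => u.
    by rewrite /h; case: (_ && _); rewrite ?expr1n ?expr0n.
  have H2 := avg_ffun_sum_sqr (T := T) V0 (fun u => (u \in U)%:R : R).
  rewrite avg_mem in H2.
  have H3 : avg (fun u => (u \in U)%:R ^+ 2 : R) = mu / K.
    rewrite -avg_mem; apply: eq_avg => u.
    by case: (u \in U); rewrite ?expr1n ?expr0n.
  rewrite H3 -/t in H2; rewrite avgZ avg_avg_h in H1.
  apply: (le_trans (lerD (ler_wpM2l _ H1) (ler_wpM2l _ H2))).
  - exact: ler0n.
  - by rewrite mulr_ge0 ?sqr_ge0.
  rewrite le_eqVlt; apply/orP; left; apply/eqP.
  by rewrite /p; field; rewrite gt_eqF.
apply: (@le_trans _ _ (avg (fun x => avg (fun y => 2 * X x y + (-1) * X x y ^+ 2)))).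
  under eq_avg do rewrite avgD !avgZ.
  by rewrite avgD !avgZ EX; lra.
apply: le_avg => x; apply: le_avg => y.
case: (boolP [exists a, _]) => [_|/existsPn no].
  by rewrite /=; have := sqr_ge0 (X x y - 1); rewrite sqrrB1 /=; lra.
have -> : X x y = 0.
  rewrite /X big1// => b _; rewrite /phi big1// => a _; rewrite /h.
  by have /existsPn/(_ b)/negbTE -> := no a.
by rewrite expr0n /=; lra.
Qed.

End Hit.

(* [g] sends a codeword index to the next index with the same symbol; only the
   last index of each of the at most [l] symbol classes has no successor. *)
Lemma partial_injection (K l mu : nat) (Q : eqType) (F : 'I_K -> Q) (P : {set 'I_K}) :
  (size (undup [seq F v | v in P]) <= l)%N -> (mu + l <= #|P|)%N ->
  exists U : {set 'I_K}, exists g : 'I_K -> 'I_K,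
    [/\ #|U| = mu, {in U &, injective g} & {in U, forall u, u != g u /\ F u = F (g u)}].
Proof.
move=> Fl muP.
pose nx (u v : 'I_K) := (u < v)%N && (F v == F u).
pose U0 := [set u in P | [exists v, nx u v]].
pose g u := if [pick v | nx u v] is Some v0 then [arg min_(v < v0 | nx u v) (v : nat)] else u.
have gP u : u \in U0 -> nx u (g u) /\ forall v, nx u v -> (g u <= v)%N.
  rewrite inE => /andP[_ /existsP[v uv]]; rewrite /g.
  case: pickP => [v0 uv0|/(_ v)]; last by rewrite uv.
  by case: arg_minnP.
have U0P : U0 \subset P by apply/fintype.subsetP => u; rewrite inE => /andP[].
have cardD : (#|P :\: U0| <= l)%N.
  apply: leq_trans Fl; rewrite cardE -(size_map F); apply: uniq_leq_size.
    rewrite map_inj_in_uniq ?enum_uniq// => u v.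
    rewrite !mem_enum !inE => /andP[+ uP] /andP[+ vP] Fuv.
    rewrite uP vP /= => /existsPn nu /existsPn nv; apply: val_inj => /=.
    have := nu v; have := nv u; rewrite /nx Fuv eqxx !andbT -!leqNgt => ? ?.
    by apply/eqP; rewrite eqn_leq; apply/andP.
  move=> q /mapP[u]; rewrite mem_enum inE => /andP[_ uP] ->.
  by rewrite mem_undup; apply/mapP; exists u; rewrite ?mem_enum.
have cardU0 : (mu <= #|U0|)%N.
  have := cardsID U0 P; rewrite (finset.setIidPr U0P) => E.
  lia.
(* [U0] is cut down to exactly [mu] elements, since the hitting bound degrades when [p] becomes
   large. *)
have : (0 < #|[set U : {set 'I_K} | U \subset U0 & #|U| == mu]|)%N.
  by rewrite cards_draws bin_gt0.
case/card_gt0P => U; rewrite inE => /andP[/fintype.subsetP UU0 /eqP cU].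
exists U, g; split=> // [u v /UU0 uU /UU0 vU guv|u /UU0 uU]; last first.
  have [/andP[ug /eqP ->] _] := gP u uU.
  by rewrite neq_ltn ug.
have [/andP[ug /eqP Fu] gu] := gP u uU; have [/andP[vg /eqP Fv] gv] := gP v vU.
have Fuv : F u = F v by rewrite -Fu -Fv guv.
(* If [u < v] had the same image, [v] would be a candidate successor of [u], whence
   [g u <= v < g v]. *)
apply: val_inj => /=; have [uv|vu|//] := ltngtP u v.
  have := gu v; rewrite /nx uv Fuv eqxx guv => /(_ isT).
  by rewrite leqNgt vg.
have := gv u; rewrite /nx vu Fuv eqxx -guv => /(_ isT).
by rewrite leqNgt ug.
Qed.

(** * From a list of close words to two tuples with many collisions *)

(** Outside [G] each [a i] is below [K * (1 - rho) ^ 2], and inside at most [K]. Comparing with the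
    lower bound on the sum gives [rho * (1 - rho) * #|~: G| <= rho * #|G|]; cancelling [rho] yields
    the ratio [(1 - rho) / (2 - rho)]. *)
Lemma many_good_coordinates (R : realFieldType) (I : finType) (K : nat) (rho thr : R)
    (a : I -> nat) :
  0 <= rho < 1 -> (0 < K)%N -> (forall i, a i <= K)%N -> thr <= K%:R * (1 - rho) ^+ 2 ->
  K%:R * ((1 - rho) * #|I|%:R) <= \sum_i (a i)%:R ->
  (1 - rho) / (2 - rho) * #|I|%:R <= #|[set i | thr <= (a i)%:R]|%:R.
Proof.
move=> /andP[rho0 rho1] K0 aK thrK suma.
set G := [set i | _].
have K0R : 0 < K%:R :> R by rewrite ltr0n.
have dI : #|I|%:R = #|G|%:R + #|~: G|%:R :> R by rewrite -natrD cardsC.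
have bound (c : R) : (forall i, i \notin G -> (a i)%:R <= c) ->
    \sum_i (a i)%:R <= #|G|%:R * K%:R + #|~: G|%:R * c.
  move=> ac; rewrite (bigID (mem G)) /=; apply: lerD.
    by rewrite mulr_natl -sumr_const ler_sum// => i _; rewrite ler_nat.
  rewrite mulr_natl -sumr_const [leRHS](eq_bigl (fun i => i \notin G)); last first.
    by move=> i; rewrite inE.
  by rewrite ler_sum.
(* At [rho = 0] nothing can be cancelled; instead the sum forces every [a i] to equal [K], so [G] is
   everything. *)
have [rho00|rhoN0] := eqVneq rho 0.
  have [G0|/finset.set0Pn[i]] := eqVneq (~: G) finset.set0.
    rewrite dI G0 cards0 rho00 addr0 !subr0; have := ler0n R #|G|; lra.
  rewrite !inE -ltNge => ai; exfalso; move: suma; apply/negP; rewrite -ltNge.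
  rewrite rho00 subr0 mul1r [K%:R * _]mulrC mulr_natl -sumr_const.
  rewrite rho00 subr0 expr1n mulr1 in thrK.
  rewrite (bigD1 i)//= [ltRHS](bigD1 i)//=; apply: ltr_leD; first exact: lt_le_trans thrK.
  by apply: ler_sum => j _; rewrite ler_nat.
have {}bound := bound (K%:R * (1 - rho) ^+ 2).
have h : #|G|%:R * K%:R + #|~: G|%:R * (K%:R * (1 - rho) ^+ 2) =
   K%:R * (#|G|%:R + #|~: G|%:R * (1 - rho) ^+ 2) :> R by ring.
have : K%:R * ((1 - rho) * #|I|%:R) <= K%:R * (#|G|%:R + #|~: G|%:R * (1 - rho) ^+ 2).
  rewrite -h; apply: le_trans suma (bound _) => i.
  by rewrite inE -ltNge => ai; apply: ltW; apply: lt_le_trans thrK.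
rewrite ler_pM2l// dI => h2.
rewrite mulrAC ler_pdivrMr; last by lra.
have rho_gt0 : 0 < rho by rewrite lt_def rhoN0.
rewrite -(ler_pM2l rho_gt0) -subr_ge0.
rewrite -subr_ge0 in h2; apply: le_trans h2 _; rewrite le_eqVlt; apply/orP; left.
by apply/eqP; ring.
Qed.

(** Here [u] stands for [2 * t / K]. With only [u <= 1 / 2] the bound would fail at [p = 1 / 64];
    [u ^ 2 <= p] ensures that [u > 1 / 4] occurs only for [p >= 1 / 16]. *)
Lemma hit_numerics (R : realFieldType) (p u : R) :
  1 / 64 <= p <= 5 / 16 -> 0 <= u <= 1 / 2 -> u ^+ 2 <= p ->
  1 / 90 <= p * (1 - u - p).
Proof.
move=> /andP[p1 p2] /andP[u0 u1] up.
have [u4|u4] := leP u (1 / 4); last first.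
  have : 1 / 16 <= p by nra.
  nra.
have [p3|p3] := leP p (1 / 16); nra.
Qed.

(** Equal words are excluded because they agree everywhere, which no distance bound could limit. *)
Definition collisions {T I Q : finType} (x y : {ffun T -> {ffun I -> Q}}) : {set I} :=
  [set i | [exists a, exists b, (x a != y b) && (x a i == y b i)]].

Lemma list_collisions (R : archiRealFieldType) (T I Q : finType) (K l : nat)
    (gamma rho : R) (e : 'I_K -> {ffun I -> Q}) (A : I -> {set Q}) :
  injective e -> 0 <= rho < 1 -> (forall i, #|A i| <= l)%N ->
  (forall v, (1 - rho) * #|I|%:R <= #|[set i | e v i \in A i]|%:R) ->
  (1 + gamma) * l%:R <= K%:R * (1 - rho) ^+ 2 -> (l <= K <= 2 * l)%N -> 4 <= gamma * l%:R ->
  l%:R <= 16 * gamma * #|T|%:R ^+ 2 -> 4 * gamma * #|T|%:R ^+ 2 <= l%:R ->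
  (4 * #|T| <= l)%N ->
  exists x y : {ffun T -> 'I_K},
    (1 - rho) / (2 - rho) * #|I|%:R / 90 <=
      #|collisions [ffun a => e (x a)] [ffun a => e (y a)]|%:R.
Proof.
move=> e_inj rho01 Al agree lK /andP[l_le_K K_le_2l] gl4 lt1 lt2 lt3.
have l0 : (0 < l)%N by rewrite lt0n; apply: contraTneq gl4 => ->; rewrite mulr0; lra.
have K0 : (0 < K)%N by exact: leq_trans l_le_K.
have V0 : (0 < #|'I_K|)%N by rewrite card_ord.
have g0 : 0 < gamma.
  by rewrite ltNge; apply/negP => g0; have := ler0n R l; nra.
pose t : R := #|T|%:R; pose Kr : R := K%:R.
pose a i := #|[set v | e v i \in A i]|.
have suma : K%:R * ((1 - rho) * #|I|%:R) <= \sum_i (a i)%:R :> R.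
  have -> : \sum_i (a i)%:R = \sum_v #|[set i | e v i \in A i]|%:R :> R.
    rewrite -!natr_sum; congr _%:R.
    under eq_bigr do rewrite /a -sum1_card.
    under [RHS]eq_bigr do rewrite -sum1_card.
    rewrite (exchange_big_dep xpredT)//=; apply: eq_bigr => v _.
    by apply: eq_bigl => i; rewrite !inE.
  rewrite -[K in leLHS]card_ord mulr_natl -sumr_const.
  by apply: ler_sum => v _; exact: agree.
have aK i : (a i <= K)%N by rewrite -[K]card_ord max_card.
have := many_good_coordinates R I K rho _ a rho01 K0 aK lK suma.
set G := [set i | _] => cardG.
(* [mu] is [gamma * l] rounded up; as [gamma * l >= 4], rounding costs at most a factor [5 / 4]. *)
have [mu mu1 mu2] : exists2 mu, gamma * l%:R <= mu%:R &
    forall k : nat, gamma * l%:R <= k%:R -> (mu <= k)%N.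
  have exm : exists k : nat, gamma * l%:R <= k%:R.
    by exists (Num.truncn (gamma * l%:R)).+1; rewrite ltW// truncnS_gt.
  by case: (ex_minnP exm) => mu ? ?; exists mu.
have mu3 : mu%:R <= 5 / 4 * (gamma * l%:R).
  have mu0 : (0 < mu)%N by rewrite -(ltr0n R); lra.
  rewrite leNgt; apply/negP => mul.
  have /mu2 : gamma * l%:R <= mu.-1%:R by rewrite -subn1 natrB//; lra.
  by rewrite leqNgt prednK// leqnn.
pose p : R := t ^+ 2 * mu%:R / Kr ^+ 2.
have Kr0 : 0 < Kr by rewrite ltr0n.
have t0 : 0 <= t by rewrite ler0n.
have lr0 : 0 < l%:R :> R by rewrite ltr0n.
have lKr : l%:R <= Kr by rewrite ler_nat.
have Klr : Kr <= 2 * l%:R by rewrite -natrM ler_nat.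
have tl : 4 * t <= l%:R by rewrite -natrM ler_nat.
(* Since [l <= K <= 2 * l] and [gamma * t ^ 2] lies between [l / 16] and [l / 4], [p] lies between
   [1 / 64] and [5 / 16]; [mu >= 4] gives [(2 * t / K) ^ 2 <= p]. *)
have num : 1 / 90 <= p * (1 - 2 * t / Kr - p).
  rewrite -/t in lt1 lt2.
  have b1 : t ^+ 2 * (gamma * l%:R) <= t ^+ 2 * mu%:R by rewrite ler_wpM2l// sqr_ge0.
  have b2 : t ^+ 2 * mu%:R <= t ^+ 2 * (5 / 4 * (gamma * l%:R)) by rewrite ler_wpM2l// sqr_ge0.
  have b3 : l%:R * l%:R <= l%:R * (16 * gamma * t ^+ 2) :> R by rewrite ler_wpM2l// ler0n.
  have b4 : l%:R * (4 * gamma * t ^+ 2) <= l%:R * l%:R :> R by rewrite ler_wpM2l// ler0n.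
  have b5 : Kr ^+ 2 <= 4 * (l%:R * l%:R) by nra.
  have b6 : l%:R * l%:R <= Kr ^+ 2 by nra.
  apply: hit_numerics.
  - apply/andP; split.
      by rewrite /p ler_pdivlMr ?exprn_gt0//; lra.
    by rewrite /p ler_pdivrMr ?exprn_gt0//; lra.
  - apply/andP; split; first by rewrite divr_ge0 ?mulr_ge0// ltW.
    by rewrite ler_pdivrMr//; lra.
  - rewrite expr_div_n exprMn /p ler_wpM2r ?invr_ge0 ?sqr_ge0//.
    have : t ^+ 2 * 4 <= t ^+ 2 * mu%:R by rewrite ler_wpM2l ?sqr_ge0//; lra.
    lra.
pose Z (x y : {ffun T -> 'I_K}) := collisions [ffun a => e (x a)] [ffun a => e (y a)].
have hit i : i \in G ->
    1 / 90 <= avg (fun x : {ffun T -> 'I_K} => avg (fun y => (i \in Z x y)%:R : R)).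
  rewrite inE /a => ai.
  set P := [set v | e v i \in A i] in ai.
  have sizeP : (size (undup [seq e v i | v in P]) <= l)%N.
    apply: leq_trans (Al i); rewrite cardE; apply: uniq_leq_size; first exact: undup_uniq.
    move=> q; rewrite mem_undup => /fintype.imageP[v]; rewrite inE => vA ->.
    by rewrite mem_enum.
  have cardP : (mu + l <= #|P|)%N.
    have lP : (l <= #|P|)%N by rewrite -(ler_nat R); nra.
    have /mu2 : gamma * l%:R <= (#|P| - l)%:R by rewrite natrB//; lra.
    by rewrite leq_subRL// addnC.
  have [U [g [cU g_inj gU]]] := partial_injection _ _ _ _ _ P sizeP cardP.
  have := @avg_hit_ge R T _ U g V0 g_inj; rewrite cU card_ord -/t -/Kr -/p => hitU.
  apply: (le_trans num); apply: (le_trans hitU).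
  apply: le_avg => x; apply: le_avg => y; rewrite ler_nat.
  case: (boolP [exists a, _]) => // /existsP[c /existsP[b /andP[xU /eqP yg]]].
  rewrite lt0b inE; apply/existsP; exists c; apply/existsP; exists b.
  rewrite !ffunE yg; have [ug eug] := gU _ xU.
  by rewrite (inj_eq e_inj) ug eug eqxx.
have F0 : (0 < #|{ffun T -> 'I_K}|)%N by rewrite card_ffun card_ord expn_gt0 K0.
(* Linearity of expectation over the good coordinates; some pair of tuples then reaches the mean. *)
have : #|G|%:R * (1 / 90) <= avg (fun x => avg (fun y => #|Z x y|%:R : R)).
  apply: (@le_trans _ _ (avg (fun x => avg (fun y => \sum_(i in G) (i \in Z x y)%:R : R)))).
    under eq_avg do rewrite avg_sum.
    by rewrite avg_sum mulr_natl -sumr_const; apply: ler_sum.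
  apply: le_avg => x; apply: le_avg => y.
  rewrite -sum1_card natr_sum big_mkcond [leRHS]big_mkcond /=.
  by apply: ler_sum => i _; case: (i \in G); case: (i \in Z x y).
case/avg_witness => // x /avg_witness -[]// y xy.
by exists x, y; apply: le_trans xy; rewrite mulrA mulr1 ler_wpM2r// invr_ge0.
Qed.

(** * Exponential moment of the intersection of a random [m]-subset with a fixed set *)

(** The ratio of the two binomials is the product of the [(m - j) / (n - j)] for [j < k], each at
    most [m / n]. *)
Lemma bin_sub_le (R : realFieldType) (n m k : nat) :
  (k <= m <= n)%N -> (0 < n)%N ->
  ('C(n - k, m - k))%:R <= ('C(n, m))%:R * (m%:R / n%:R) ^+ k :> R.
Proof.
move=> /andP[km mn] n0; elim: k km => [|k IH] km; first by rewrite !subn0 expr0 mulr1.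
have nk0 : 0 < (n - k)%:R :> R by rewrite ltr0n subn_gt0 (leq_trans km).
have step : ('C(n - k.+1, m - k.+1))%:R = ('C(n - k, m - k))%:R * ((m - k)%:R / (n - k)%:R) :> R.
  have := mul_bin_diag (n - k) (m - k.+1); rewrite -subnS.
  have -> : (m - k.+1).+1 = (m - k)%N by rewrite subnSK.
  move=> /(congr1 (fun i => i%:R : R)); rewrite !natrM => E.
  by apply: (mulfI (lt0r_neq0 nk0)); rewrite E; field; rewrite lt0r_neq0.
rewrite step exprSr [leRHS]mulrA; apply: ler_pM; [exact: ler0n | by rewrite divr_ge0 ?ler0n | exact: IH (ltnW km) |].
rewrite ler_pdivrMr// mulrAC ler_pdivlMr ?ltr0n//.
have k0 := ler0n R k; have mnR : m%:R <= n%:R :> R by rewrite ler_nat.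
rewrite !natrB ?(leq_trans (ltnW km))// ?(ltnW km)//; nra.
Qed.

(** A random [m]-subset contains [T] with at most the probability given by independent sampling at
    rate [m / #|I|]. This is how sampling without replacement is handled. *)
Lemma card_supersets_le (R : realFieldType) (I : finType) (m : nat) (T : {set I}) :
  (0 < #|I|)%N -> (m <= #|I|)%N ->
  #|[set S : {set I} | (#|S| == m) && (T \subset S)]|%:R
    <= ('C(#|I|, m))%:R * (m%:R / #|I|%:R) ^+ #|T| :> R.
Proof.
move=> I0 mI; case: (leqP #|T| m) => Tm; last first.
  rewrite (_ : [set _ | _] = finset.set0) ?cards0 ?mulr_ge0 ?exprn_ge0 ?divr_ge0//.
  apply/finset.setP => S; rewrite !inE; apply/negP => /andP[/eqP Sm /subset_leq_card].
  by rewrite Sm leqNgt Tm.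
apply: le_trans (bin_sub_le R #|I| m #|T| _ I0); last by rewrite Tm.
have -> : (#|I| - #|T|)%N = #|~: T| by rewrite [RHS]cardsCs finset.setCK.
rewrite ler_nat -cards_draws.
(* Removing [T] maps its supersets injectively to subsets of its complement. *)
rewrite -(card_in_imset (f := fun S => S :\: T)); last first.
  move=> S S'; rewrite !inE => /andP[_ /finset.setIidPr TS] /andP[_ /finset.setIidPr TS'] E.
  by rewrite -(finset.setID S T) -(finset.setID S' T) TS TS' E.
apply: subset_leq_card; apply/fintype.subsetP => S' /imsetP[S].
rewrite !inE => /andP[/eqP Sm TS] ->.
by rewrite finset.subsetDr cardsD (finset.setIidPr TS) Sm eqxx.
Qed.

Lemma sum_subsets_expr (R : comNzRingType) (I : finType) (A : {set I}) (c : R) :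
  \sum_(T : {set I} | T \subset A) c ^+ #|T| = (1 + c) ^+ #|A|.
Proof.
transitivity (\prod_i ((if i \in A then c else 0) + 1)).
  rewrite bigA_distr; rewrite big_mkcond; apply: eq_bigr => T _.
  rewrite -big_mkcond; case: ifP => [TA|].
    rewrite -prodr_const; apply: eq_bigr => i iT.
    by rewrite (fintype.subsetP TA).
  move=> /negbT/fintype.subsetPn[i iT iA].
  by rewrite (bigD1 i)//= (negbTE iA) mul0r.
rewrite -prodr_const [RHS]big_mkcond; apply: eq_bigr => i _.
by case: ifP; rewrite ?add0r// addrC.
Qed.

(** The power is expanded over the subsets [T] of [S :&: B], the sets [S] containing each [T] are
    counted, the sum over subsets of [B] is folded back, and [1 + x <= expR x] concludes. *)
Lemma sum_expr_card_setI_le (R : realType) (I : finType) (m : nat) (B : {set I}) (c : R) :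
  (0 < #|I|)%N -> (m <= #|I|)%N -> 0 <= c ->
  \sum_(S : {set I} | #|S| == m) (1 + c) ^+ #|S :&: B|
    <= ('C(#|I|, m))%:R * expR (c * (m%:R * #|B|%:R / #|I|%:R)).
Proof.
move=> I0 mI c0.
under eq_bigr do rewrite -sum_subsets_expr.
rewrite (exchange_big_dep (fun T : {set I} => T \subset B))/=; last first.
  by move=> S T _; rewrite finset.subsetI => /andP[].
apply: (@le_trans _ _ (\sum_(T : {set I} | T \subset B)
    ('C(#|I|, m))%:R * (c * (m%:R / #|I|%:R)) ^+ #|T|)).
  apply: ler_sum => T TB; rewrite sumr_const -[leLHS]mulr_natr exprMn [leRHS]mulrCA.
  rewrite ler_wpM2l ?exprn_ge0//; apply: le_trans (card_supersets_le R I m T I0 mI).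
  rewrite ler_nat; apply: subset_leq_card; apply/fintype.subsetP => S.
  by move=> /andP[Sm]; rewrite finset.subsetI inE Sm => /andP[].
rewrite -mulr_sumr ler_wpM2l// sum_subsets_expr.
apply: (@le_trans _ _ (expR (c * (m%:R / #|I|%:R)) ^+ #|B|)).
  by rewrite lerXn2r ?nnegrE ?expR_ge0 ?addr_ge0 ?mulr_ge0 ?expR_ge1Dx.
rewrite -expRM_natl ler_expR le_eqVlt; apply/orP; left; apply/eqP; ring.
Qed.

(** * Collisions of codeword tuples: forced by a bad [S], limited by the distance *)

Lemma close_to_prod_agree (R : realType) (I : finType) (q : nat) (rho : R)
    (A : {ffun I -> {set 'I_q}}) (c : {ffun I -> 'I_q}) :
  close_to_prod rho A c -> (1 - rho) * #|I|%:R <= #|[set i | c i \in A i]|%:R.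
Proof.
case/existsP => y /andP[/forallP yA cy].
have sub : [set i | c i == y i] \subset [set i | c i \in A i].
  by apply/fintype.subsetP => i; rewrite !inE => /eqP ->.
have E : (hamming c y + #|[set i | c i == y i]| = #|I|)%N.
  rewrite -(cardsC [set i | c i != y i]); congr (_ + #|pred_of_set _|)%N.
  by apply/finset.setP => i; rewrite !inE negbK.
apply: (@le_trans _ _ #|[set i | c i == y i]|%:R); last by rewrite ler_nat subset_leq_card.
by move: E => /(congr1 (fun k => k%:R : R)); rewrite natrD => E; lra.
Qed.

Lemma not_list_recoverable_collisions (R : realType) (alpha rho gamma : R)
    (n q l t : nat) (C : {set {ffun 'I_n -> 'I_q}}) (S : {set 'I_n}) :
  0 < alpha < 1 -> 0 <= rho < 1 -> gamma = (1 + alpha) * (1 - rho) ^+ 2 - 1 ->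
  4 <= gamma * l%:R -> l%:R <= 16 * gamma * t%:R ^+ 2 -> 4 * gamma * t%:R ^+ 2 <= l%:R ->
  (4 * t <= l)%N -> ~~ list_recoverable (puncture C S) rho l (l%:R * (1 + alpha)) ->
  exists x y : {ffun 'I_t -> {ffun 'I_n -> 'I_q}},
    [/\ forall a, x a \in C, forall b, y b \in C &
    (1 - rho) / (2 - rho) * #|S|%:R / 90 <= #|S :&: collisions x y|%:R].
Proof.
move=> /andP[al0 al1] rho01 gE gl4 lt1 lt2 lt3.
rewrite negb_forall => /existsP[A]; rewrite negb_imply -ltNge => /andP[/forallP Al].
set Bd := [set c in _ | _] => LBd.
have l0 : 0 <= l%:R :> R := ler0n _ _.
have L0 : 0 <= l%:R * (1 + alpha) by nra.
have lpos : 0 < l%:R :> R by rewrite lt_def l0 andbT; apply: contraTneq gl4 => ->; rewrite mulr0; lra.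
(* The least integer above [l * (1 + alpha)]; [alpha < 1] keeps it at most [2 * l]. *)
pose K := (Num.truncn (l%:R * (1 + alpha))).+1.
have [trL LK] := andP (truncn_itv L0).
have KB : (K <= #|Bd|)%N by rewrite /K -(ltr_nat R); apply: le_lt_trans LBd.
have K2 : (K <= 2 * l)%N by rewrite /K -(ltr_nat R) natrM; apply: le_lt_trans trL _; nra.
have lK : (l <= K)%N by rewrite -(ler_nat R); apply: le_trans (ltW LK); nra.
pose rs (c : {ffun 'I_n -> 'I_q}) := [ffun i : {i : 'I_n | i \in S} => c (val i)].
pose e (v : 'I_K) := enum_val (widen_ord KB v).
have e_inj : injective e.
  by move=> u v /enum_val_inj /(congr1 val) /= uv; apply: val_inj.
have eB v : e v \in Bd by apply: enum_valP.
(* Each listed word is lifted to a codeword of [C]. Distinct restrictions have distinct lifts, so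
   collisions survive lifting. *)
have /fin_all_exists[c cP] : forall v, exists c, c \in C /\ e v = rs c.
  by move=> v; have := eB v; rewrite inE => /andP[/imsetP[c cC ->] _]; exists c.
have cardI : #|{: {i : 'I_n | i \in S}}| = #|S| by rewrite card_sig.
have agree v : (1 - rho) * #|{: {i : 'I_n | i \in S}}|%:R <= #|[set i | e v i \in A i]|%:R.
  by apply: close_to_prod_agree; have := eB v; rewrite inE => /andP[].
have thrK : (1 + gamma) * l%:R <= K%:R * (1 - rho) ^+ 2.
  rewrite gE addrC subrK mulrC mulrA ler_wpM2r ?sqr_ge0//.
  exact: ltW.
have lK2 : (l <= K <= 2 * l)%N by rewrite lK.
rewrite -(card_ord t) in lt1 lt2 lt3.
have [x [y xy]] := list_collisions R 'I_t _ _ K l gamma rho e (fun i => A i)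
  e_inj rho01 Al agree thrK lK2 gl4 lt1 lt2 lt3.
exists [ffun a => c (x a)], [ffun a => c (y a)]; split.
- by move=> a; rewrite ffunE; case: (cP (x a)).
- by move=> a; rewrite ffunE; case: (cP (y a)).
rewrite -cardI; apply: le_trans xy _; rewrite ler_nat.
rewrite -(card_imset _ val_inj); apply: subset_leq_card.
apply/fintype.subsetP => _ /imsetP[i + ->]; rewrite !inE (valP i) /=.
case/existsP => a /existsP[b /andP[ab abi]].
apply/existsP; exists a; apply/existsP; exists b; move: ab abi; rewrite !ffunE.
rewrite (cP (x a)).2 (cP (y b)).2 !ffunE => ab ->; rewrite andbT.
by apply: contraNneq ab => ->.
Qed.

(** Distinct codewords agree in at most [D] places, and there are [t ^ 2] pairs of positions. *)
Lemma card_collisions_le (R : realType) (I : finType) (q t : nat) (D : R)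
    (C : {set {ffun I -> 'I_q}}) (x y : {ffun 'I_t -> {ffun I -> 'I_q}}) :
  @min_dist_ge R _ _ C (#|I|%:R - D) -> 0 <= D ->
  (forall a, x a \in C) -> (forall b, y b \in C) ->
  #|collisions x y|%:R <= t%:R ^+ 2 * D.
Proof.
move=> dC D0 xC yC.
pose ag a b := [set i | (x a != y b) && (x a i == y b i)].
have agD a b : #|ag a b|%:R <= D.
  have [xy|xy] := eqVneq (x a) (y b).
    rewrite (_ : ag a b = finset.set0) ?cards0//.
    by apply/finset.setP => i; rewrite !inE xy eqxx.
  have := dC _ _ (xC a) (yC b) xy.
  have E : (hamming (x a) (y b) + #|ag a b| = #|I|)%N.
    rewrite -(cardsC [set i | x a i != y b i]); congr (_ + #|pred_of_set _|)%N.
    by apply/finset.setP => i; rewrite !inE xy negbK.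
  by move: E => /(congr1 (fun k => k%:R : R)); rewrite natrD => E; lra.
apply: (@le_trans _ _ (\sum_(a < t) \sum_(b < t) #|ag a b|%:R)).
  rewrite -sum1_card natr_sum.
  under [leRHS]eq_bigr do under eq_bigr do rewrite -sum1_card natr_sum big_mkcond.
  under [leRHS]eq_bigr do rewrite exchange_big.
  rewrite exchange_big big_mkcond; apply: ler_sum => i _ /=.
  case: ifP => [|_]; last by rewrite !sumr_ge0// => a _; rewrite sumr_ge0// => b _; case: ifP.
  rewrite inE => /existsP[a /existsP[b abi]].
  rewrite (bigD1 a)//= (bigD1 b)//= inE abi -addrA lerDl addr_ge0// sumr_ge0// => *; last first.
    by rewrite sumr_ge0// => *; case: ifP.
  by case: ifP.
rewrite expr2 -mulrA; apply: (@le_trans _ _ (\sum_(a < t) t%:R * D)).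
  apply: ler_sum => a _; apply: (@le_trans _ _ (\sum_(b < t) D)); first by apply: ler_sum.
  by rewrite sumr_const card_ord mulr_natl.
by rewrite sumr_const card_ord -[leLHS]mulr_natl.
Qed.

(** * Chernoff bound combined with the union bound *)

(** From [1 + x <= expR x] at [x = - (1 / 6)] one gets [expR (1 / 3) <= 36 / 25], whose cube is at
    most 3. The value 9 provides the factor 8 in the Chernoff exponent. *)
Lemma expR2_le9 (R : realType) : expR 2 <= 9 :> R.
Proof.
set a : R := expR (1 / 3).
have a0 : 0 < a by rewrite expR_gt0.
have a1 : a <= 36 / 25.
  have b : 5 / 6 <= expR (- (1 / 6)) :> R by have := expR_ge1Dx (- (1 / 6) : R); lra.
  have : a * expR (- (1 / 6)) ^+ 2 = 1.
    by rewrite -expRM_natl -expRD -[RHS]expR0; congr expR; field.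
  have : 25 / 36 <= expR (- (1 / 6)) ^+ 2 :> R by nra.
  nra.
have a2 : a ^+ 2 <= 52 / 25 by nra.
have a3 : a ^+ 3 <= 3 by rewrite exprS; nra.
have -> : expR 2 = a ^+ 3 ^+ 2.
  by rewrite -exprM -expRM_natl; congr expR; field.
have : 0 <= a ^+ 3 by rewrite exprn_ge0// ltW.
nra.
Qed.

(** Each [S] in [X] has some [w] with [expR (2 * #|S :&: B w| - 2 * c) >= 1]; summing over all [w]
    and all [m]-subsets leaves exponential moments with [1 + c] there equal to [expR 2]. *)
Lemma card_large_intersection_le (R : realType) (I : finType) (m : nat) (X : {set {set I}})
    (W : finType) (P : {set W}) (B : W -> {set I}) (b c : R) :
  (0 < #|I|)%N -> (m <= #|I|)%N ->
  (forall S, S \in X -> #|S| = m /\ exists2 w, w \in P & c <= #|S :&: B w|%:R) ->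
  (forall w, w \in P -> #|B w|%:R <= b) ->
  #|X|%:R <= #|P|%:R * ('C(#|I|, m))%:R * expR (8 * (m%:R * b / #|I|%:R) - 2 * c).
Proof.
move=> I0 mI XP Bb.
have E2 : expR 2 = 1 + (expR 2 - 1) :> R by rewrite addrC subrK.
have l0 : 0 <= expR 2 - 1 :> R by have := expR_ge1Dx (2 : R); lra.
have I0R : 0 < #|I|%:R :> R by rewrite ltr0n.
apply: (@le_trans _ _ (\sum_(S : {set I} | #|S| == m) \sum_(w in P)
    expR 2 ^+ #|S :&: B w| * expR (- (2 * c)))).
  have ge0 (S : {set I}) : 0 <= \sum_(w in P) expR 2 ^+ #|S :&: B w| * expR (- (2 * c)) :> R.
    by rewrite sumr_ge0// => w _; rewrite mulr_ge0 ?exprn_ge0 ?expR_ge0.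
  rewrite -sum1_card natr_sum big_mkcond [leRHS]big_mkcond; apply: ler_sum => S _ /=.
  case: ifP => [/XP[-> [w wP cw]]|_]; last by case: ifP.
  rewrite eqxx (bigD1 w)//= -[leLHS]addr0 lerD//; last first.
    by rewrite sumr_ge0// => v _; rewrite mulr_ge0 ?exprn_ge0 ?expR_ge0.
  rewrite -expRM_natl -expRD -[leLHS]expR0 ler_expR; lra.
rewrite exchange_big /= -[leRHS]mulrA [leRHS]mulr_natl -sumr_const; apply: ler_sum => w wP.
rewrite -mulr_suml E2 (expRD (8 * _)) [leRHS]mulrA ler_wpM2r ?expR_ge0//.
apply: le_trans (sum_expr_card_setI_le R I m (B w) _ I0 mI l0) _.
rewrite ler_wpM2l// ler_expR; apply: ler_pM.
- exact: l0.
- by rewrite divr_ge0// mulr_ge0.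
- by have := expR2_le9 R; lra.
- by rewrite ler_wpM2r ?invr_ge0 ?(ltW I0R)// ler_wpM2l ?Bb.
Qed.

(** * Choice of the tuple length and numerical constants *)

(** With [w = sqrt (l / gamma)], take for [t] the integer part of [w / 2]. As [w >= 2], truncation
    loses at most half, so [w / 4 <= t]; and [gamma * w >= 2] gives [4 * t <= 2 * w <= l]. *)
Lemma tuple_length_exists (R : realType) (gamma : R) (l : nat) :
  0 < gamma < 1 -> 4 <= gamma * l%:R ->
  exists t : nat, [/\ l%:R <= 16 * gamma * t%:R ^+ 2, 4 * gamma * t%:R ^+ 2 <= l%:R,
    (4 * t <= l)%N & 2 * t%:R <= Num.sqrt (l%:R / gamma)].
Proof.
move=> /andP[gamma0 gamma1] gl4.
set w := Num.sqrt _.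
have w0 : 0 <= w by rewrite sqrtr_ge0.
have w2 : w ^+ 2 * gamma = l%:R 
  by rewrite sqr_sqrtr ?divfK ?gt_eqF// divr_ge0 ?ler0n// ltW.
have gw2 : 4 <= (gamma * w) ^+ 2 by move: gl4; rewrite -w2; lra.
have gw : 2 <= gamma * w.
  have := mulr_ge0 (ltW gamma0) w0; nra.
have w_ge2 : 2 <= w by nra.
have w_le : 2 * w <= l%:R by rewrite -w2; nra.
have w20 : 0 <= w / 2 by lra.
pose t := Num.truncn (w / 2).
have [tw1 tw2] := andP (truncn_itv w20).
rewrite -/t -(natr1 t) in tw1 tw2.
have t1 : 1 <= t%:R :> R by rewrite ler1n /t truncn_gt0; lra.
exists t; split.
- have h : (w / 4) ^+ 2 <= t%:R ^+ 2 by apply: lerXn2r; rewrite ?nnegrE; lra.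
  by rewrite -w2; have := ler_wpM2r (ltW gamma0) h; lra.
- have h : t%:R ^+ 2 <= (w / 2) ^+ 2 by apply: lerXn2r; rewrite ?nnegrE; lra.
  by rewrite -w2; have := ler_wpM2r (ltW gamma0) h; lra.
- by rewrite -(ler_nat R) natrM; lra.
- lra.
Qed.

Lemma collision_density_le (R : realFieldType) (sigma gamma l n d t2 : R) :
  0 < gamma -> 0 < d -> 0 < n -> 4 * gamma * t2 <= l ->
  l <= sigma * gamma * n / (800 * d) -> t2 * (2 * d) / n <= sigma / 1600.
Proof.
move=> gamma0 d0 n0 tl.
have d800 : 0 < 800 * d by lra.
rewrite (ler_pdivlMr _ _ d800) => ld.
have h := ler_wpM2r (ltW d0) tl.
rewrite ler_pdivrMr// -(ler_pM2l gamma0); lra.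
Qed.

(** The three terms come from the number of pairs of tuples, the mean intersection and the
    threshold; the constants work because [1 / 1280 + 1 / 200 - 1 / 45 <= - (1 / 64)]. *)
Lemma union_bound_exponent (R : realFieldType) (sigma m n u w y : R) :
  0 < sigma * m -> 0 <= m -> 1280 * w * y <= sigma * m -> u / n <= sigma / 1600 ->
  w * y + (8 * (m * u / n) - 2 * (sigma * m / 90)) <= - (sigma * m / 64).
Proof.
move=> sm0 m0 wy /(ler_wpM2l m0); rewrite -mulrA; lra.
Qed.

(** * Counting the bad [m]-subsets *)

Theorem theorem2 (R : realType) (alpha rho : R) (q n d ell m : nat)
    (C : {set {ffun 'I_n -> 'I_q}}) :
  0 < alpha < 1 ->
  0 <= rho -> rho < 1 - (Num.sqrt (1 + alpha))^-1 ->
  (0 < q)%N -> (0 < n)%N -> (0 < d)%N -> (0 < ell)%N -> (0 < m)%N ->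
  @min_dist_ge R _ _ C (n%:R - n%:R / q%:R - d%:R) ->
  let gamma := (1 + alpha) * (1 - rho) ^+ 2 - 1 in
  let sigma := (1 - rho) / (2 - rho) in
  n%:R / q%:R <= d%:R :> R ->
  4 / gamma <= ell%:R ->
  ell%:R <= sigma * gamma * n%:R / (800 * d%:R) ->
  1280 * Num.sqrt (ell%:R / gamma) * ln (#|C|%:R) <= sigma * m%:R ->
  (m < n)%N ->
  1 - expR (- (sigma * m%:R / 64))
    <= #|[set S : {set 'I_n} | (#|S| == m)
           && list_recoverable (puncture C S) rho ell (ell%:R * (1 + alpha))]|%:R
       / ('C(n, m))%:R.
Proof.
move=> al01 rho0 rho_lt _ n0 d0 l0 m0 distC gamma sigma nqd gl ld lnC mn.
have [al0 al1] := andP al01.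
set s := Num.sqrt (1 + alpha) in rho_lt.
have s0 : 0 < s by rewrite sqrtr_gt0; lra.
have s2 : s ^+ 2 = 1 + alpha by rewrite sqr_sqrtr//; lra.
(* The hypothesis on [rho] in the form that makes [gamma] positive after squaring. *)
have sr1 : 1 < s * (1 - rho).
  by rewrite -ltr_pdivrMl// mulr1; lra.
have rho1 : rho < 1 by rewrite (lt_trans rho_lt)// gtrBl invr_gt0.
have rho01 : 0 <= rho < 1 by rewrite rho0 rho1.
have gamma0 : 0 < gamma.
  by rewrite /gamma -s2 -exprMn; nra.
have gamma1 : gamma < 1 by rewrite /gamma; nra.
have sigma0 : 0 < sigma by rewrite divr_gt0; lra.
have lr0 : 0 < ell%:R :> R by rewrite ltr0n.
have nr0 : 0 < n%:R :> R by rewrite ltr0n.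
have dr0 : 0 < d%:R :> R by rewrite ltr0n.
have gl4 : 4 <= gamma * ell%:R by rewrite mulrC -ler_pdivrMr.
have [|t [lt1 lt2 lt3 tw]] := tuple_length_exists R gamma ell _ gl4.
  by rewrite gamma0 gamma1.
set w := Num.sqrt (ell%:R / gamma) in lnC tw.
set good := [set S | _].
pose bad := [set S : {set 'I_n} | (#|S| == m)
  && ~~ list_recoverable (puncture C S) rho ell (ell%:R * (1 + alpha))].
have cardE : #|good|%:R + #|bad|%:R = ('C(n, m))%:R :> R.
  rewrite -natrD -[in RHS](card_ord n) -card_draws; congr _%:R.
  rewrite -[RHS](cardsID [set S | list_recoverable (puncture C S) rho ell (ell%:R * (1 + alpha))]).
  by congr (_ + _)%N; apply: eq_card => S; rewrite !inE andbC.
pose word := {ffun 'I_n -> 'I_q}.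
pose Ct := [set x : {ffun 'I_t -> word} | x \in ffun_on (mem C)].
pose P := finset.setX Ct Ct.
have cardP : #|P|%:R <= expR (w * ln #|C|%:R) :> R.
  (* For an empty code [ln] takes its default value 0 at 0, so that case is treated apart. *)
  have lnC0 : 0 <= ln #|C|%:R :> R.
    by case: #|C| => [|k]; [rewrite ln0 | rewrite ln_ge0 ?ler1n].
  have Cexp : #|C|%:R <= expR (ln #|C|%:R) :> R.
    by case: #|C| => [|k]; rewrite ?expR_ge0// lnK// posrE ltr0n.
  have -> : #|P| = (#|C| ^ (t + t))%N.
    by rewrite cardsX !cardsE !card_ffun_on card_ord expnD.
  rewrite natrX; apply: (@le_trans _ _ (expR (ln #|C|%:R) ^+ (t + t))).
    by rewrite lerXn2r ?nnegrE ?expR_ge0.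
  by rewrite -expRM_natl ler_expR natrD ler_wpM2r//; lra.
have badle : #|bad|%:R <= #|P|%:R * ('C(n, m))%:R *
    expR (8 * (m%:R * (t%:R ^+ 2 * (2 * d%:R)) / n%:R) - 2 * (sigma * m%:R / 90)).
  have := card_large_intersection_le R 'I_n m bad _ P (fun xy => collisions xy.1 xy.2)
    (t%:R ^+ 2 * (2 * d%:R)) (sigma * m%:R / 90).
  rewrite card_ord; apply=> //; first exact: ltnW.
  - move=> S; rewrite inE => /andP[/eqP Sm nlr]; split=> //.
    have [x [y [xC yC xy]]] := not_list_recoverable_collisions R alpha rho gamma n q ell t C S
      al01 rho01 erefl gl4 lt1 lt2 lt3 nlr.
    exists (x, y); last by rewrite -Sm.
    by rewrite !inE /=; apply/andP; split; apply/ffun_onP.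
  - move=> [x y]; rewrite !inE /= => /andP[/ffun_onP xC /ffun_onP yC].
    apply: card_collisions_le (xC) (yC); last by lra.
    (* Here [n / q <= d] weakens the distance hypothesis to [n - 2 * d]. *)
    move=> c c' cC c'C cc'; apply: le_trans (distC c c' cC c'C cc').
    by rewrite card_ord; lra.
have Cnm0 : 0 < ('C(n, m))%:R :> R by rewrite ltr0n bin_gt0 ltnW.
rewrite ler_pdivlMr// mulrBl mul1r -{1}cardE.
suff : #|bad|%:R <= expR (- (sigma * m%:R / 64)) * ('C(n, m))%:R by lra.
apply: (le_trans badle); rewrite mulrAC ler_wpM2r//.
apply: (le_trans (ler_wpM2r (expR_ge0 _) cardP)); rewrite -expRD ler_expR.
apply: union_bound_exponent => //.
  by rewrite mulr_gt0// ltr0n.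
exact: collision_density_le lt2 ld.
Qed.
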